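(* (Weak cocommutativity.) Let $M$ be a comodule over a graded vertex coalgebra $V$ and let $v'\in(V\otimes V\otimes M)'$. There exists $k\in\mathbb{Z}_+$ such that $$(x_1-x_2)^k\left\langle v',\,(Id_V\otimes\mathcal{Y}_M(x_2))\mathcal{Y}_M(x_1)w-(T\otimes Id_M)(Id_V\otimes\mathcal{Y}_M(x_1))\mathcal{Y}_M(x_2)w\right\rangle=0$$ for any $w\in M$.
   Context: All vector spaces are over a field $\mathbb{F}$ of characteristic $0$; $x,x_0,x_1,x_2$ are commuting formal variables; $\mathbb{Z}_+$ is the set of positive integers. $\delta(x)=\sum_{n\in\mathbb{Z}}x^n$. For $n\in\mathbb{Z}$, $(x_i\pm x_j)^n$ is expanded in nonnegative integral powers of the second listed variable $x_j$ (this also applies inside $\delta$). $W[[x,x^{-1}]]$ is the space of all doubly infinite formal series with coefficients in $W$, and $W((x^{-1}))$ is the space of those with only finitely many positive powers of $x$. $T(u\otimes v)=v\otimes u$ on $V\otimes V$. Linear maps and pairings act on formal series coefficientwise. A vertex coalgebra $(V,\mathcal{Y}_V,c)$ is a vector space $V$ with linear maps $\mathcal{Y}_V(x):V\to(V\otimes V)[[x,x^{-1}]]$ and $c:V\to\mathbb{F}$ such that for all $v\in V$: (left counit) $(c\otimes Id_V)\mathcal{Y}_V(x)v=v$; (cocreation) $(Id_V\otimes c)\mathcal{Y}_V(x)v\in V[[x]]$ and $\lim_{x\to0}(Id_V\otimes c)\mathcal{Y}_V(x)v=v$; (truncation) $\mathcal{Y}_V(x)v\in(V\otimes V)((x^{-1}))$;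 (Jacobi identity) $$x_0^{-1}\delta\left(\tfrac{x_1-x_2}{x_0}\right)(Id_V\otimes\mathcal{Y}_V(x_2))\mathcal{Y}_V(x_1)-x_0^{-1}\delta\left(\tfrac{x_2-x_1}{-x_0}\right)(T\otimes Id_V)(Id_V\otimes\mathcal{Y}_V(x_1))\mathcal{Y}_V(x_2)=x_2^{-1}\delta\left(\tfrac{x_1-x_0}{x_2}\right)(\mathcal{Y}_V(x_0)\otimes Id_V)\mathcal{Y}_V(x_2).$$ It is a graded vertex coalgebra if $V=\coprod_{k\in\mathbb{Z}}V_{(k)}$ is $\mathbb{Z}$-graded with $V_{(k)}=0$ for $k$ sufficiently negative and, writing $\mathcal{Y}_V(x)v=\sum_{k\in\mathbb{Z}}\Delta_k(v)x^{-k-1}$, $\Delta_k(v)\in(V\otimes V)_{(r+k+1)}$ for all $v\in V_{(r)}$, $r,k\in\mathbb{Z}$. A comodule over a graded vertex coalgebra $V$ is a $\mathbb{Q}$-graded vector space $M=\coprod_{j\in\mathbb{Q}}M_{(j)}$ with $M_{(j)}=0$ for $j$ sufficiently negative, equipped with a linear map $\mathcal{Y}_M(x):M\to(V\otimes M)[[x,x^{-1}]]$ such that, writing $\mathcal{Y}_M(x)w=\sum_{k\in\mathbb{Z}}\Delta_k(w)x^{-k-1}$, $\Delta_k(w)\in(V\otimes M)_{(j+k+1)}$ for $w\in M_{(j)}$, and for all $w\in M$: 1. Left counit: $(c\otimes Id_M)\mathcal{Y}_M(x)w=w$. 2. Truncation: $\mathcal{Y}_M(x)w\in(V\otimes M)((x^{-1}))$.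 3. Jacobi identity: $$x_0^{-1}\delta\left(\tfrac{x_1-x_2}{x_0}\right)(Id_V\otimes\mathcal{Y}_M(x_2))\mathcal{Y}_M(x_1)-x_0^{-1}\delta\left(\tfrac{x_2-x_1}{-x_0}\right)(T\otimes Id_M)(Id_V\otimes\mathcal{Y}_M(x_1))\mathcal{Y}_M(x_2)=x_2^{-1}\delta\left(\tfrac{x_1-x_0}{x_2}\right)(\mathcal{Y}_V(x_0)\otimes Id_M)\mathcal{Y}_M(x_2).$$ For a graded space $W=\coprod_k W_{(k)}$, the graded dual is $W'=\coprod_k\mathrm{Hom}(W_{(k)},\mathbb{F})$, and $\langle\cdot,\cdot\rangle$ is the natural pairing of $W'$ with $W$. Tensor products are graded by total weight. *)

(* Defs.v *)
From HB Require Import structures.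
From mathcomp Require Import all_boot all_order all_algebra.
From mathcomp Require Import boolp classical_sets functions cardinality fsbigop.
From mathcomp Require Import freeg.

Set Implicit Arguments.
Unset Strict Implicit.
Unset Printing Implicit Defensive.

Import Order.TTheory GRing.Theory Num.Theory.
Local Open Scope classical_set_scope.
Local Open Scope ring_scope.
Local Open Scope quotient_scope.

Section Span.
Context {F : fieldType} {W : lmodType F}.

Definition subspace (P : set W) : Prop :=
  P 0 /\ forall (a : F) u v, P u -> P v -> P (a *: u + v).

Definition span (S : set W) : set W := smallest subspace S.

Lemma span_subspace (S : set W) : subspace (span S).
Proof.
split; first by move=> P [[P0 _] _].
by move=> a u v Su Sv P PS; case: (PS) => [[_ PL] _]; apply: PL; [exact: Su|exact: Sv].
Qed.

Lemma span0 (S : set W) : span S 0.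
Proof. by case: (span_subspace S). Qed.

Lemma spanZ (S : set W) a u : span S u -> span S (a *: u).
Proof.
by case: (span_subspace S) => S0 SL Su; rewrite -[_ *: _]addr0; exact: SL.
Qed.

Lemma spanD (S : set W) u v : span S u -> span S v -> span S (u + v).
Proof.
by case: (span_subspace S) => _ SL *; rewrite -[u]scale1r; exact: SL.
Qed.

End Span.

(* mathcomp has no tensor product of arbitrary vector spaces.  [tensor U V] is
   the quotient of the free vector space on [U * V] by the span of the bilinear
   relations; [tliftE], [tlift_linear] and [tlift_uniq] are its universal
   property. *)

Section TensorDef.
Context {F : fieldType} (U V : lmodType F).
Local Notation free := {freeg (U * V)%type / F}.
Local Notation "<< p >>" := (Freeg [:: (1, p)] : free).

Inductive bilinear_relation : set free :=
| BilinearRelL a u1 u2 v :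
    bilinear_relation (<< (a *: u1 + u2, v) >> - a *: << (u1, v) >> - << (u2, v) >>)
| BilinearRelR a u v1 v2 :
    bilinear_relation (<< (u, a *: v1 + v2) >> - a *: << (u, v1) >> - << (u, v2) >>).

Definition tensor_null : {pred free} := fun x => `[< span bilinear_relation x >].

Lemma tensor_nullE x : (x \in tensor_null) = `[< span bilinear_relation x >].
Proof. by []. Qed.

Fact tensor_null_zmod_closed : zmod_closed tensor_null.
Proof.
split; first by rewrite tensor_nullE; apply/asboolP; exact: span0.
move=> x y; rewrite !tensor_nullE => /asboolP Sx /asboolP Sy; apply/asboolP.
by rewrite -scaleN1r; apply: spanD => //; exact: spanZ.
Qed.

HB.instance Definition _ :=
  GRing.isZmodClosed.Build free tensor_null tensor_null_zmod_closed.

Definition tensor := Quotient.quot (tensor_null : zmodClosed free).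

HB.instance Definition _ := GRing.Zmodule.on tensor.
HB.instance Definition _ := Quotient.on tensor.

Lemma pi_tensor_eq (x y : free) :
  \pi_tensor x = \pi_tensor y <-> span bilinear_relation (x - y).
Proof.
split; first by move/eqP; rewrite -Quotient.idealrBE => /asboolP.
by move=> xy; apply/eqP; rewrite -Quotient.idealrBE; apply/asboolP.
Qed.

Lemma pi_tensor_surj (t : tensor) : exists x : free, t = \pi_tensor x.
Proof. by exists (repr t); rewrite reprK. Qed.

Lemma pi_tensorD (x y : free) :
  \pi_tensor (x + y) = \pi_tensor x + \pi_tensor y.
Proof. exact: (Quotient.pi_add tensor_null x y). Qed.

Definition tensor_scale (a : F) (t : tensor) : tensor := \pi_tensor (a *: repr t).

Lemma pi_tensorZ a (x : free) :
  \pi_tensor (a *: x) = tensor_scale a (\pi_tensor x).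
Proof.
apply/pi_tensor_eq; rewrite -scalerBr; apply: spanZ.
by apply/pi_tensor_eq; rewrite reprK.
Qed.

Fact tensor_scaleA a b t :
  tensor_scale a (tensor_scale b t) = tensor_scale (a * b) t.
Proof. by have [x ->] := pi_tensor_surj t; rewrite -!pi_tensorZ scalerA. Qed.

Fact tensor_scale1 : left_id 1 tensor_scale.
Proof. by move=> t; have [x ->] := pi_tensor_surj t; rewrite -pi_tensorZ scale1r. Qed.

Fact tensor_scaleDr : right_distributive tensor_scale +%R.
Proof.
move=> a s t; have [x ->] := pi_tensor_surj s; have [y ->] := pi_tensor_surj t.
by rewrite -pi_tensorD -!pi_tensorZ scalerDr pi_tensorD.
Qed.

Fact tensor_scaleDl t : {morph tensor_scale^~ t : a b / a + b}.
Proof.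
by move=> a b; have [x ->] := pi_tensor_surj t; rewrite -!pi_tensorZ scalerDl pi_tensorD.
Qed.

HB.instance Definition _ := GRing.Zmodule_isLmodule.Build F tensor
  tensor_scaleA tensor_scale1 tensor_scaleDr tensor_scaleDl.

Definition tens (u : U) (v : V) : tensor := \pi_tensor << (u, v) >>.

Fact pi_tensor_linear : linear (\pi_tensor : free -> tensor).
Proof. by move=> a x y; rewrite pi_tensorD pi_tensorZ. Qed.

Lemma tens_linearl v : linear (tens^~ v).
Proof.
move=> a u1 u2; rewrite /tens -pi_tensor_linear; apply/pi_tensor_eq.
by rewrite opprD addrA; apply: sub_gen_smallest; exact: BilinearRelL.
Qed.

Lemma tens_linearr u : linear (tens u).
Proof.
move=> a v1 v2; rewrite /tens -pi_tensor_linear; apply/pi_tensor_eq.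
by rewrite opprD addrA; apply: sub_gen_smallest; exact: BilinearRelR.
Qed.

Lemma tensor_span (t : tensor) :
  span [set s | exists u v, s = tens u v] t.
Proof.
have [x ->] := pi_tensor_surj t; rewrite -[x]freeg_sumE.
elim: (dom _) => [|[u v] s IH]; first by rewrite big_nil raddf0; exact: span0.
rewrite big_cons pi_tensorD; apply: spanD => //.
set c := coeff _ _; have -> : Freeg [:: (c, (u, v))] = c *: << (u, v) >>.
  by apply/eqP/freeg_eqP => p; rewrite coeffZ !coeffU mul1r.
rewrite pi_tensorZ; apply: (@spanZ _ tensor); apply: sub_gen_smallest => /=.
by exists u, v.
Qed.

End TensorDef.

Notation "U ⊗ V" := (tensor U V) (at level 40, left associativity) : type_scope.
Notation "u *t v" := (tens u v) (at level 40, left associativity) : ring_scope.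

Section TensorLift.
Context {F : fieldType} {U V W : lmodType F}.
Local Notation free := {freeg (U * V)%type / F}.

Definition bilinear_map (f : U -> V -> W) : Prop :=
  (forall v, linear (f^~ v)) /\ (forall u, linear (f u)).

(* The linear map with [u *t v |-> f u v]; meaningful when [f] is bilinear. *)
Definition tlift (f : U -> V -> W) (t : U ⊗ V) : W :=
  fglift (fun p => f p.1 p.2) (repr t).

Lemma fglift_linear (g : U * V -> W) : linear (fglift g : free -> W).
Proof.
have g0 : fglift g (0 : free) = 0.
  by have := lift_is_additive g (0 : free) 0; rewrite !subrr.
have gN (x : free) : fglift g (- x) = - fglift g x.
  by rewrite -sub0r lift_is_additive g0 sub0r.
have gD (x y : free) : fglift g (x + y) = fglift g x + fglift g y.
  by rewrite -[y in LHS]opprK lift_is_additive gN opprK.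
move=> a x y; rewrite gD; congr (_ + _).
rewrite -[x]freeg_sumE; elim: (dom _) => [|p s IH].
  by rewrite big_nil scaler0 g0 scaler0.
rewrite big_cons scalerDr !gD scalerDr IH; congr (_ + _).
rewrite liftU scalerA -(liftU g); congr fglift.
by apply/eqP/freeg_eqP => q; rewrite coeffZ !coeffU mulrA.
Qed.

Section Bilinear.
Context (f : U -> V -> W) (bf : bilinear_map f).

Lemma tlift_pi (x : free) :
  tlift f (\pi_(U ⊗ V) x) = fglift (fun p => f p.1 p.2) x.
Proof.
rewrite /tlift; set g := fun p => _; set y := repr _.
have : span (@bilinear_relation _ U V) (y - x) by apply/pi_tensor_eq; rewrite reprK.
have gL := fglift_linear g.
have gB a b : fglift g (a - b) = fglift g a - fglift g (b : free).
  have -> : a - b = -1 *: b + a by rewrite scaleN1r addrC.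
  by rewrite gL scaleN1r addrC.
have g0 : fglift g (0 : free) = 0 by rewrite -(subrr x) gB subrr.
have gZ a b : fglift g (a *: b) = a *: fglift g (b : free).
  by have := gL a b 0; rewrite addr0 => ->; rewrite g0 addr0.
have [fl fr] := bf.
move=> yx; apply/subr0_eq; rewrite -gB.
apply: (yx [set z : free | fglift g z = 0]); split.
  split => /=.
- exact: g0.
- by move=> a u v; rewrite gL => -> ->; rewrite scaler0 addr0.
move=> z [a u1 u2 v|a u v1 v2] /=; rewrite !gB gZ !liftU !scale1r /g /=.
- by rewrite fl addrAC addrK subrr.
- by rewrite fr addrAC addrK subrr.
Qed.

Lemma tlift_linear : linear (tlift f).
Proof.
move=> a s t; have [x ->] := pi_tensor_surj s; have [y ->] := pi_tensor_surj t.
rewrite -pi_tensor_linear !tlift_pi.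
exact: fglift_linear.
Qed.

Lemma tliftE u v : tlift f (u *t v) = f u v.
Proof. by rewrite /tens tlift_pi liftU scale1r. Qed.

Lemma tlift_uniq (g : U ⊗ V -> W) : linear g ->
  (forall u v, g (u *t v) = f u v) -> g =1 tlift f.
Proof.
move=> gL gE t; have z (h : U ⊗ V -> W) : linear h -> h 0 = 0.
  by move=> hL; have := hL (-1) 0 0; rewrite scaler0 addr0 scaleN1r addNr.
apply: (tensor_span t (i := [set s | g s = tlift f s])); split.
  split => /=.
- by rewrite !z //; exact: tlift_linear.
- by move=> a x y gx gy; rewrite gL tlift_linear gx gy.
by move=> _ [u [v ->]] /=; rewrite gE tliftE.
Qed.

End Bilinear.
End TensorLift.

Section TensorMaps.
Context {F : fieldType}.

Definition tmap {U U' V V' : lmodType F} (f : U -> U') (g : V -> V') :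
    U ⊗ V -> U' ⊗ V' :=
  tlift (fun u v => f u *t g v).

Definition tswap {U V : lmodType F} : U ⊗ V -> V ⊗ U := tlift (fun u v => v *t u).

Definition tassoc {U V W : lmodType F} : U ⊗ V ⊗ W -> U ⊗ (V ⊗ W) :=
  tlift (fun t w => tlift (fun u v => u *t (v *t w)) t).

Definition tassoc_inv {U V W : lmodType F} : U ⊗ (V ⊗ W) -> U ⊗ V ⊗ W :=
  tlift (fun u t => tlift (fun v w => u *t v *t w) t).

(* [T (x) Id_W] transported to the association used for triple tensors. *)
Definition tswap12 {U V W : lmodType F} (t : U ⊗ (V ⊗ W)) : V ⊗ (U ⊗ W) :=
  tassoc (tmap tswap id (tassoc_inv t)).

(* [c (x) Id_W] and [Id_U (x) c], composed with the identifications
   [F (x) W = W] and [U (x) F = U]. *)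
Definition tcontractl {V W : lmodType F} (c : V -> F) : V ⊗ W -> W :=
  tlift (fun v w => c v *: w).

Definition tcontractr {U V : lmodType F} (c : V -> F) : U ⊗ V -> U :=
  tlift (fun u v => c v *: u).

Lemma bilinear_tens {U V U' V' : lmodType F} (f : {linear U -> U'})
  (g : {linear V -> V'}) : bilinear_map (fun u v => f u *t g v).
Proof.
split=> [v a u1 u2|u a v1 v2] /=; rewrite linearP.
- exact: tens_linearl.
- exact: tens_linearr.
Qed.

Lemma tmapE {U V U' V' : lmodType F} (f : {linear U -> U'})
  (g : {linear V -> V'}) u v : tmap f g (u *t v) = f u *t g v.
Proof. exact: (tliftE (bilinear_tens f g)). Qed.

Lemma tmap_linear {U V U' V' : lmodType F} (f : {linear U -> U'})
  (g : {linear V -> V'}) : linear (tmap f g).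
Proof. exact: (tlift_linear (bilinear_tens f g)). Qed.

Lemma bilinear_tswap {U V : lmodType F} :
  bilinear_map (fun (u : U) (v : V) => v *t u).
Proof. by split=> [v|u]; [exact: tens_linearr|exact: tens_linearl]. Qed.

Lemma tswapE {U V : lmodType F} (u : U) (v : V) : tswap (u *t v) = v *t u.
Proof. exact: (tliftE bilinear_tswap). Qed.

Lemma tswap_linear {U V : lmodType F} : linear (@tswap U V).
Proof. exact: (tlift_linear bilinear_tswap). Qed.

Section Assoc.
Context {U V W : lmodType F}.

Lemma bilinear_tassoc_in (w : W) :
  bilinear_map (fun (u : U) (v : V) => u *t (v *t w)).
Proof.
split=> [v|u a v1 v2]; first exact: tens_linearl.
by rewrite tens_linearl tens_linearr.
Qed.

Lemma bilinear_tassoc : bilinear_map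
  (fun (t : U ⊗ V) (w : W) => tlift (fun u v => u *t (v *t w)) t).
Proof.
split=> [w|t a w1 w2]; first exact: (tlift_linear (bilinear_tassoc_in w)).
symmetry; move: t; apply: (tlift_uniq (bilinear_tassoc_in _)) => [b s t|u v].
  rewrite !(tlift_linear (bilinear_tassoc_in _)) !scalerDr !scalerA mulrC.
  by rewrite addrACA.
by rewrite !(tliftE (bilinear_tassoc_in _)) -!tens_linearr.
Qed.

Lemma tassocE (u : U) (v : V) (w : W) : tassoc (u *t v *t w) = u *t (v *t w).
Proof.
by rewrite /tassoc (tliftE bilinear_tassoc) (tliftE (bilinear_tassoc_in _)).
Qed.

Lemma tassoc_linear : linear (@tassoc U V W).
Proof. exact: (tlift_linear bilinear_tassoc). Qed.

Lemma bilinear_tassoc_inv_in (u : U) :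
  bilinear_map (fun (v : V) (w : W) => u *t v *t w).
Proof.
split=> [w a v1 v2|v]; last exact: tens_linearr.
by rewrite tens_linearr tens_linearl.
Qed.

Lemma bilinear_tassoc_inv : bilinear_map
  (fun (u : U) (t : V ⊗ W) => tlift (fun v w => u *t v *t w) t).
Proof.
split=> [t a u1 u2|u]; last exact: (tlift_linear (bilinear_tassoc_inv_in u)).
symmetry; move: t; apply: (tlift_uniq (bilinear_tassoc_inv_in _)) => [b s t|v w].
  rewrite !(tlift_linear (bilinear_tassoc_inv_in _)) !scalerDr !scalerA mulrC.
  by rewrite addrACA.
by rewrite !(tliftE (bilinear_tassoc_inv_in _)) -!tens_linearl.
Qed.

Lemma tassoc_invE (u : U) (v : V) (w : W) :
  tassoc_inv (u *t (v *t w)) = u *t v *t w.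
Proof.
rewrite /tassoc_inv (tliftE bilinear_tassoc_inv).
by rewrite (tliftE (bilinear_tassoc_inv_in _)).
Qed.

Lemma tassoc_inv_linear : linear (@tassoc_inv U V W).
Proof. exact: (tlift_linear bilinear_tassoc_inv). Qed.

End Assoc.

Lemma tcontractlE {V W : lmodType F} (c : {scalar V}) (v : V) (w : W) :
  tcontractl c (v *t w) = c v *: w.
Proof.
apply: tliftE; split=> [{}w a v1 v2|{}v a w1 w2] /=.
- by rewrite linearP scalerDl scalerA.
- by rewrite scalerDr !scalerA mulrC.
Qed.

Lemma tcontractrE {U V : lmodType F} (c : {scalar V}) (u : U) (v : V) :
  tcontractr c (u *t v) = c v *: u.
Proof.
apply: tliftE; split=> [{}v a u1 u2|{}u a v1 v2] /=.
- by rewrite scalerDr !scalerA mulrC.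
- by rewrite linearP scalerDl scalerA.
Qed.

End TensorMaps.

Section Gradings.
Context {F : fieldType}.

(* [W] is the coproduct of the subspaces [Wt i]. *)
Definition grading {I : choiceType} {W : lmodType F} (Wt : I -> set W) : Prop :=
  (forall i, subspace (Wt i)) /\
  forall w : W, exists! f : I -> W,
    [/\ forall i, Wt i (f i), finite_set [set i | f i != 0]
      & w = \sum_(i \in [set: I]) f i].

(* Total weight; [add] adds the weights of the two factors. *)
Definition tensor_grading {I J K : Type} {U V : lmodType F} (add : I -> J -> K)
    (Ut : I -> set U) (Vt : J -> set V) (k : K) : set (U ⊗ V) :=
  span [set t | exists i j u v, [/\ add i j = k, Ut i u, Vt j v & t = u *t v]].

(* The graded dual of [W = coprod_i Wt i].  A functional on [W] is a family in
   [prod_i Hom (Wt i, F)]; it belongs to the coproduct of these spaces when only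
   finitely many members of the family are nonzero. *)
Record graded_dual {I : choiceType} {W : lmodType F} (Wt : I -> set W) :=
  GradedDual {
    gd_fun :> {scalar W};
    gd_finite : finite_set [set i | exists2 w, Wt i w & gd_fun w != 0]
  }.

End Gradings.

(* A [W]-valued formal series in variables with exponents in [E] is its family
   of coefficients [E -> W]: the exponents are [int * int] for [(x1, x2)] and
   [int * int * int] for [(x0, x1, x2)]. *)

Section Series.
Context {F : fieldType}.

(* Cauchy product.  [\sum_(m \in _)] is the sum of a finitely supported family,
   so this is the intended product whenever every coefficient of it is a finite
   sum, as is the case in all the uses below. *)
Definition series_mul {E : zmodType} {W : lmodType F} (d : E -> F) (A : E -> W) :
    E -> W :=
  fun e => \sum_(m \in [set: E]) d m *: A (e - m).

Definition binomial_coef (n : int) (i : nat) : F :=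
  (\prod_(j < i) (n - j%:Z)%:~R) / (i`!)%:R.

(* [(x - y)^n] expanded in nonnegative powers of [y]; the exponents are those of
   [x] and [y] in this order. *)
Definition sub_pow (n : int) : int * int -> F := fun '(a, b) =>
  if (0 <= b) && (a + b == n) then (-1) ^+ `|b|%N * binomial_coef n `|b|%N else 0.

(* The coefficient of [x^a] in [x^-1 delta(y / x)] is [y^(-a-1)]. *)

(* x0^-1 delta((x1 - x2) / x0) *)
Definition delta_x0_12 : int * int * int -> F := fun '(a, b, c) =>
  sub_pow (- a - 1) (b, c).

(* x0^-1 delta((x2 - x1) / (- x0)) *)
Definition delta_x0_21 : int * int * int -> F := fun '(a, b, c) =>
  (-1) ^ (- a - 1) * sub_pow (- a - 1) (c, b).

(* x2^-1 delta((x1 - x0) / x2) *)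
Definition delta_x2_10 : int * int * int -> F := fun '(a, b, c) =>
  sub_pow (- c - 1) (b, a).

Definition series_x1x2 {W : lmodType F} (A : int * int -> W) :
    int * int * int -> W :=
  fun '(a, b, c) => if a == 0 then A (b, c) else 0.

Definition series_x0x2 {W : lmodType F} (A : int * int -> W) :
    int * int * int -> W :=
  fun '(a, b, c) => if b == 0 then A (a, c) else 0.

End Series.

(* A linear map [Y(x)] into [W[[x, x^-1]]] is given by the linear maps [Y n]
   sending a vector to the coefficient of [x^n]. *)

Section Coalgebras.
Context {F : fieldType} {V M : lmodType F}.
Implicit Types (YV : int -> {linear V -> V ⊗ V}) (YM : int -> {linear M -> V ⊗ M}).

(* [Y(x) w = sum_k Delta_k(w) x^(-k-1)] *)
Definition Delta YM (k : int) (w : M) : V ⊗ M := YM (- k - 1) w.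

Definition left_counit (c : {scalar V}) YM : Prop :=
  forall w n, tcontractl c (YM n w) = if n == 0 then w else 0.

Definition truncation YM : Prop :=
  forall w, exists N : int, forall n, N < n -> YM n w = 0.

(* (Id_V (x) Y_M(x2)) Y_M(x1) w *)
Definition iter12 YM (w : M) : int * int -> V ⊗ (V ⊗ M) := fun '(b, c) =>
  tmap id (YM c) (YM b w).

(* (T (x) Id_M) (Id_V (x) Y_M(x1)) Y_M(x2) w *)
Definition iter21 YM (w : M) : int * int -> V ⊗ (V ⊗ M) := fun '(b, c) =>
  tswap12 (tmap id (YM b) (YM c w)).

(* (Y_V(x0) (x) Id_M) Y_M(x2) w, a series in [x0, x2] *)
Definition iter02 YV YM (w : M) : int * int -> V ⊗ (V ⊗ M) := fun '(a, c) =>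
  tassoc (tmap (YV a) id (YM c w)).

Definition jacobi YV YM : Prop := forall (w : M) (e : int * int * int),
  series_mul delta_x0_12 (series_x1x2 (iter12 YM w)) e
  - series_mul delta_x0_21 (series_x1x2 (iter21 YM w)) e
  = series_mul delta_x2_10 (series_x0x2 (iter02 YV YM w)) e.

End Coalgebras.

Record vertex_coalgebra {F : fieldType} (V : lmodType F) := VertexCoalgebra {
  vc_Y : int -> {linear V -> V ⊗ V};
  vc_counit : {scalar V};
  vc_left_counit : left_counit vc_counit vc_Y;
  vc_cocreation : forall v,
    (forall n, n < 0 -> tcontractr vc_counit (vc_Y n v) = 0)
    /\ tcontractr vc_counit (vc_Y 0 v) = v;
  vc_truncation : truncation vc_Y;
  vc_jacobi : jacobi vc_Y vc_Y
}.

Record graded_vertex_coalgebra {F : fieldType} (V : lmodType F) :=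
  GradedVertexCoalgebra {
    gvc_vc :> vertex_coalgebra V;
    gvc_wt : int -> set V;
    gvc_grading : grading gvc_wt;
    gvc_bounded : exists k0, forall k, k < k0 -> gvc_wt k = [set 0];
    gvc_weight : forall (r k : int) v, gvc_wt r v ->
      tensor_grading +%R gvc_wt gvc_wt (r + k + 1) (Delta (vc_Y gvc_vc) k v)
  }.

(* The weight of [v *t w] for [v] of weight [i : int] and [w] of weight [j : rat]. *)
Definition add_weight (i : int) (j : rat) : rat := i%:~R + j.

Record comodule {F : fieldType} {V : lmodType F} (GV : graded_vertex_coalgebra V)
    (M : lmodType F) :=
  Comodule {
    cm_Y : int -> {linear M -> V ⊗ M};
    cm_wt : rat -> set M;
    cm_grading : grading cm_wt;
    cm_bounded : exists j0, forall j, j < j0 -> cm_wt j = [set 0];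
    cm_weight : forall (j : rat) (k : int) w, cm_wt j w ->
      tensor_grading add_weight (gvc_wt GV) cm_wt (j + k%:~R + 1) (Delta cm_Y k w);
    cm_left_counit : left_counit (vc_counit GV) cm_Y;
    cm_truncation : truncation cm_Y;
    cm_jacobi : jacobi (vc_Y GV) cm_Y
  }.

Definition VVM_wt {F : fieldType} {V : lmodType F} {GV : graded_vertex_coalgebra V}
    {M : lmodType F} (CM : comodule GV M) : rat -> set (V ⊗ (V ⊗ M)) :=
  tensor_grading add_weight (gvc_wt GV)
    (tensor_grading add_weight (gvc_wt GV) (cm_wt CM)).

(* Main.v *)
Require Import Defs.
From HB Require Import structures.
From mathcomp Require Import all_boot all_order all_algebra.
From mathcomp Require Import boolp classical_sets.
From mathcomp Require Import functions cardinality fsbigop.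

Set Implicit Arguments.
Unset Strict Implicit.
Unset Printing Implicit Defensive.

Import Order.TTheory GRing.Theory Num.Theory.
Local Open Scope ring_scope.

(** Weak cocommutativity is the coefficient of [x0^(-k-1)] in the Jacobi
    identity.  For [k >= 0] both delta functions on its left-hand side contribute
    the polynomial [(x1 - x2)^k], so that this coefficient reads
    [(x1 - x2)^k] times the difference of the two iterates, equal to the
    coefficient of [x0^(-k-1)] in the term with
    [(Y_V(x0) (x) Id_M) Y_M(x2) w].  The factor [x2^-1 delta((x1 - x0) / x2)]
    has only nonnegative powers of [x0], so that coefficient involves
    [(Y_V(x0) (x) Id_M) Y_M(x2) w] only in powers [x0^a] with [a <= -k-1].  It
    remains to bound the poles in [x0] of this series, paired with [v'],
    uniformly in [w].

    The bound comes from the gradings ([iter02_pole_bound]).  The coefficient of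
    [x0^a] in [Y_V(x0)] lowers weights by [a], hence sends [u *t m], with [u] of
    weight [i] and [m] of weight [l], to weight [i + l - a].  The weights [i]
    and [l] are bounded below, whereas [v'] kills all sufficiently large weights;
    so [v'] kills the whole image once [a] is sufficiently negative.  The bound
    depends on the gradings of [V] and [M] and on [v'], but not on the vector of
    [V ⊗ M] acted upon, which is why a single [k] serves every [w].

    Characteristic 0 enters through the binomial coefficients, defined by a
    division by [i!]: it makes them the integers ['C(k, i)] for [k >= 0], whence
    the symmetry [(-1)^k (x2 - x1)^k = (x1 - x2)^k] ([sub_pow_sym]) that gives
    both delta functions the same coefficient. *)

(** * Products of formal series with a polynomial *)

Section SeriesMul.
Context {F : fieldType}.

Definition finitely_supported {E : zmodType} (d : E -> F) : Prop :=
  exists s : seq E, forall m, m \notin s -> d m = 0.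

(** The list [s] is independent of the series [A]: a sum with infinitely many
    nonzero terms takes the default value 0, and [series_mul] is additive in [A]
    only because all products by [d] can be computed over one finite list. *)
Lemma series_mul_finite {E : zmodType} (d : E -> F) : finitely_supported d ->
  exists s : seq E, forall (W : lmodType F) (A : E -> W) e,
    series_mul d A e = \sum_(m <- s) d m *: A (e - m).
Proof.
case=> s ds; exists (undup s) => W A e; rewrite /series_mul.
rewrite (fsbigE (undup s)) ?undup_uniq // => [|m _].
  by apply: eq_bigl => m; rewrite in_setT.
by rewrite mem_undup => /ds ->; rewrite scale0r.
Qed.

Lemma series_mul_linear {E : zmodType} {U W : lmodType F} (f : {linear U -> W})
    (d : E -> F) (A : E -> U) e : finitely_supported d ->
  f (series_mul d A e) = series_mul d (fun m => f (A m)) e.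
Proof.
case/series_mul_finite => s sE; rewrite !sE linear_sum.
by apply: eq_bigr => m _; rewrite linearZ.
Qed.

Lemma series_mulB {E : zmodType} {W : lmodType F} (d : E -> F) (A B : E -> W) e :
  finitely_supported d ->
  series_mul d (fun m => A m - B m) e = series_mul d A e - series_mul d B e.
Proof.
case/series_mul_finite => s sE; rewrite !sE -sumrB.
by apply: eq_bigr => m _; rewrite scalerBr.
Qed.

(** Vanishing passes from the coefficients of [A] to its product by a doubly
    infinite series such as a delta function: a coefficient of the product is
    either a finite sum of terms killed by [f] or the default value 0. *)
Lemma linear_series_mul_eq0 {E : zmodType} {U W : lmodType F}
    (f : {linear U -> W}) (d : E -> F) (A : E -> U) e :
  (forall m, d m *: f (A (e - m)) = 0) -> f (series_mul d A e) = 0.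
Proof.
move=> fA0; rewrite /series_mul linear_sum big1 // => m _.
by rewrite linearZ; exact: fA0.
Qed.

(** The series [A] does not involve [x0], so the coefficient of [x0^a] in
    [d * A] only sees the part of [d] of degree [a] in [x0]. *)
Lemma series_mul_x1x2 {W : lmodType F} (d : int * int * int -> F)
    (A : int * int -> W) a b c :
  series_mul d (series_x1x2 A) (a, b, c)
  = series_mul (fun '(b', c') => d (a, b', c')) A (b, c).
Proof.
pose h (p : int * int) : int * int * int := (a, p.1, p.2).
have hinj : set_inj [set: int * int]%classic h.
  by move=> [b1 c1] [b2 c2] _ _ [-> ->].
rewrite /series_mul -(fsbig_widen (h @` setT)%classic); first last.
- move=> [[a' b'] c'] [_ /=] nh; case: eqP; rewrite ?scaler0 // => /eqP.
  rewrite subr_eq0 => /eqP aE; case: nh; exists (b', c') => //=.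
  by rewrite /h /= aE.
- by [].
rewrite fsbig_image //; apply: eq_fsbigr => -[b' c'] _ /=.
by rewrite subrr.
Qed.

Lemma binomial_coef_nat (k i : nat) : [pchar F] =i pred0 ->
  binomial_coef k%:Z i = ('C(k, i))%:R :> F.
Proof.
move=> char0; have fact_neq0 : (i`!)%:R != 0 :> F.
  by rewrite ((pcharf0P F).1 char0) -lt0n fact_gt0.
apply: (mulIf fact_neq0); rewrite /binomial_coef divfK // -natrM bin_ffact.
have [ik|ki] := leqP i k; last first.
  by rewrite ffact_small // (bigD1 (Ordinal ki)) //= subrr mul0r.
rewrite ffact_prod natr_prod; apply: eq_bigr => j _.
by rewrite subzn // ltnW // (leq_trans (ltn_ord j)).
Qed.

(** The binomial theorem: a nonnegative power of [x - y] is a polynomial. *)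
Lemma sub_pow_finite (k : nat) : [pchar F] =i pred0 ->
  finitely_supported (sub_pow k%:Z : int * int -> F).
Proof.
move=> char0; exists [seq (k%:Z - i%:Z, i%:Z) | i <- iota 0 k.+1] => -[a b] /mapP ab.
rewrite /sub_pow; case: ifP => // /andP[]; case: b ab => // i ab _ /eqP ai /=.
rewrite binomial_coef_nat // bin_small ?mulr0 // ltnNge; apply/negP => ik.
by apply: ab; exists i; rewrite ?mem_iota // -ai addrK.
Qed.

(** [(-1)^k (y - x)^k = (x - y)^k].  The two sides are expanded in powers of
    different variables, so this rests on the symmetry of the binomial
    coefficients, and fails for negative exponents. *)
Lemma sub_pow_sym (k : nat) (a b : int) : [pchar F] =i pred0 ->
  (-1) ^+ k * sub_pow k%:Z (b, a) = sub_pow k%:Z (a, b) :> F.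
Proof.
move=> char0; rewrite /sub_pow addrC.
case: (a + b =P k%:Z) => [abk|]; rewrite ?andbF ?mulr0 // !andbT.
(* a monomial with a negative exponent is excluded on one side by the sign test,
   on the other by the vanishing of the binomial coefficient beyond [k] *)
have vanish (u v : int) : u + v = k%:Z -> u < 0 -> 0 <= v ->
    (-1) ^+ `|v|%N * binomial_coef k%:Z `|v|%N = 0 :> F.
  case: v => // v uvk u0 _; rewrite binomial_coef_nat // bin_small ?mulr0 //=.
  by rewrite -ltz_nat -uvk gtrDr.
have [a0|a0] := leP 0 a; have [b0|b0] := leP 0 b; rewrite ?mulr0 //.
- case: a b a0 b0 abk => // a [] // b _ _ [<-] /=.
  rewrite !binomial_coef_nat // -bin_sub ?leq_addr // addKn mulrA.
  by congr (_ * _); rewrite exprD mulrAC -expr2 sqrr_sign mul1r.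
- by rewrite (vanish b a) ?mulr0 // addrC.
- by rewrite (vanish a b).
Qed.

End SeriesMul.

(** * Graded spaces and their graded duals *)


Section Weights.
Context {F : fieldType}.

Lemma subspace_ker {U W : lmodType F} (f : {linear U -> W}) :
  subspace [set u | f u = 0]%classic.
Proof.
by split=> [|a u v /= fu fv]; rewrite /= ?linear0 // linearP fu fv scaler0 addr0.
Qed.

Lemma subspace_preimage {U W : lmodType F} (f : {linear U -> W}) (P : set W) :
  subspace P -> subspace (f @^-1` P)%classic.
Proof.
by case=> P0 PL; split=> [|a u v Pu Pv]; rewrite /= ?linear0 // linearP; exact: PL.
Qed.

Lemma span_min {W : lmodType F} (S P : set W) : subspace P ->
  (S `<=` P)%classic -> (Defs.span S `<=` P)%classic.
Proof. by move=> Psub SP w; apply. Qed.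

Lemma linear_eq0_graded {I : choiceType} {U W : lmodType F} (Wt : I -> set U)
    (f : {linear U -> W}) : grading Wt ->
  (forall i u, Wt i u -> f u = 0) -> forall u, f u = 0.
Proof.
case=> _ Wtdec f0 u; have [g [[gWt _ ->] _]] := Wtdec u.
by rewrite linear_sum big1 // => i _; exact: f0 (gWt i).
Qed.

Lemma linear_eq0_tens {U V W : lmodType F} (f : {linear U ⊗ V -> W}) :
  (forall u v, f (u *t v) = 0) -> forall t, f t = 0.
Proof.
move=> f0 t; apply: (span_min (subspace_ker f) _ (tensor_span t)).
by move=> _ [u [v ->]]; exact: f0.
Qed.

Lemma finite_set_ub (S : set rat) : finite_set S ->
  exists B : rat, forall r, S r -> r <= B.
Proof.
case/finite_seqP => s ->; elim: s => [|x s [B sB]]; first by exists 0.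
exists (Num.max x B) => r; rewrite /= inE le_max => /orP[/eqP->|/sB ->].
  by rewrite lexx.
by rewrite orbT.
Qed.

(** A functional of the graded dual lives in finitely many weights, hence kills
    all sufficiently large ones. *)
Lemma graded_dual_ub {W : lmodType F} (Wt : rat -> set W)
    (v' : graded_dual Wt) :
  exists B : rat, forall r w, B < r -> Wt r w -> v' w = 0.
Proof.
have [B SB] := finite_set_ub (gd_finite v').
exists B => r w Br Wrw; apply: contra_ltP Br => /eqP vw0; apply: SB.
by exists w.
Qed.

End Weights.

(** * Poles of the iterate of [Y_V] and [Y_M] *)

Section TensorLinear.
Context {F : fieldType} {U V W U' V' : lmodType F}.
Context (f : {linear U -> U'}) (g : {linear V -> V'}).

HB.instance Definition _ :=
  GRing.isLinear.Build F (U ⊗ V) (U' ⊗ V') *:%R (tmap f g) (tmap_linear f g).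

HB.instance Definition _ :=
  GRing.isLinear.Build F (U ⊗ V ⊗ W) (U ⊗ (V ⊗ W)) *:%R tassoc tassoc_linear.

(** The map [tens^~ v], under a head constant on which linearity can be
    declared. *)
Definition tensl (v : V) (u : U) : U ⊗ V := u *t v.

HB.instance Definition _ v :=
  GRing.isLinear.Build F U (U ⊗ V) *:%R (tensl v) (tens_linearl v).

HB.instance Definition _ u :=
  GRing.isLinear.Build F V (U ⊗ V) *:%R (tens u) (tens_linearr u).

End TensorLinear.

Section Iterates.
Context {F : fieldType} (V : lmodType F) (GV : graded_vertex_coalgebra V)
  (M : lmodType F) (CM : comodule GV M).

Definition YV_tens_id (a : int) : {linear V ⊗ M -> V ⊗ (V ⊗ M)} :=
  (@tassoc F V V M) \o (tmap (vc_Y GV a) (idfun : {linear M -> M})).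

(** The coefficient of [x^a] in [Y_V(x)] is [Delta_(-a-1)], which shifts weights
    by [(-a-1) + 1 = -a]. *)
Lemma YV_tens_id_weight (a i : int) (l : rat) u m :
  gvc_wt GV i u -> cm_wt CM l m ->
  VVM_wt CM (add_weight (i - a) l) (YV_tens_id a (u *t m)).
Proof.
move=> iu lm; rewrite /YV_tens_id /= tmapE.
have := @gvc_weight _ _ GV i (- a - 1) u iu.
have -> : i + (- a - 1) + 1 = i - a by rewrite addrA subrK.
have -> : Delta (vc_Y GV) (- a - 1) u = vc_Y GV a u.
  by rewrite /Delta opprB addrC addKr opprK.
pose f : {linear V ⊗ V -> V ⊗ (V ⊗ M)} := (@tassoc F V V M) \o tensl m.
rewrite -[tassoc _]/(f (vc_Y GV a u)).
apply: (span_min (subspace_preimage f (span_subspace _))).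
move=> _ [i1 [i2 [u1 [u2 [<- i1u1 i2u2 ->]]]]]; rewrite /= /tensl tassocE.
apply: sub_gen_smallest; exists i1, (add_weight i2 l), u1, (u2 *t m); split=> //.
  by rewrite /add_weight rmorphD addrA.
by apply: sub_gen_smallest; exists i2, l, u2, m.
Qed.

(** Homogeneous tensors span [V ⊗ M], and on those of weights [i] and [l] the
    image has weight [i + l - a], at least [k0 + j0 - a] when [k0] and [j0] bound
    the weights of [V] and [M] from below.  This exceeds every weight [<= B] seen
    by [v'] as soon as [a < k0 + j0 - B]. *)
Lemma iter02_pole_bound (v' : graded_dual (VVM_wt CM)) :
  exists N : nat, forall (a : int) t, a < - N%:Z -> v' (YV_tens_id a t) = 0.
Proof.
have [B v'0] := graded_dual_ub v'.
have [k0 GV0] := gvc_bounded GV; have [j0 CM0] := cm_bounded CM.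
pose N := Num.floor (add_weight k0 j0 - B).
exists `|N|%N => a t aN; have aB : a%:~R < add_weight k0 j0 - B.
  rewrite (lt_le_trans _ (Num.Theory.floor_le _)) // ltr_int (lt_le_trans aN) //.
  by rewrite abszE lerNnormlW.
pose f : {linear V ⊗ M -> F^o} := v' \o YV_tens_id a.
apply: (linear_eq0_tens (f := f)) => u m.
apply: (linear_eq0_graded (f := f \o tensl m) (gvc_grading GV)) => i {}u iu.
apply: (linear_eq0_graded (f := f \o tens u) (cm_grading CM)) => l {}m lm.
have [/GV0 GVi|k0i] := ltP i k0.
  by move: iu; rewrite GVi => ->; exact: (linear0 (f \o tensl m)).
have [/CM0 CMl|j0l] := ltP l j0.
  by move: lm; rewrite CMl => ->; exact: (linear0 (f \o tens u)).
apply: (v'0 _ _ _ (YV_tens_id_weight iu lm)).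
move: aB; rewrite /add_weight ltrBrDr -ltrBrDl => /lt_le_trans; apply.
by rewrite rmorphB /= addrAC lerD // lerD // ler_int.
Qed.

End Iterates.

Theorem proposition4p3 (F : fieldType) (charF0 : [pchar F] =i pred0)
    (V : lmodType F) (GV : graded_vertex_coalgebra V)
    (M : lmodType F) (CM : comodule GV M)
    (v' : graded_dual (VVM_wt CM)) :
  exists k : nat, (0 < k)%N /\
    forall (w : M) (e : int * int),
      series_mul (sub_pow k%:Z)
        (fun e' => v' (iter12 (cm_Y CM) w e' - iter21 (cm_Y CM) w e') : F^o) e = 0.
Proof.
have [N v'0] := iter02_pole_bound v'.
exists N.+1; split=> // w [b c].
have kfin := sub_pow_finite N.+1 charF0; set k := N.+1 in kfin *.
pose f : {linear V ⊗ (V ⊗ M) -> F^o} := gd_fun v'.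
rewrite -[LHS](series_mul_linear f _ _ kfin) series_mulB //.
(* the coefficient of [x0^(-k-1)] in the Jacobi identity *)
have := cm_jacobi CM w (- k%:Z - 1, b, c); rewrite !series_mul_x1x2.
have -> : (fun '(b', c') => delta_x0_12 (- k%:Z - 1, b', c')) = sub_pow k%:Z :> (_ -> F).
  by apply: funext => -[b' c']; rewrite /delta_x0_12 opprB addrC addKr opprK.
have -> : (fun '(b', c') => delta_x0_21 (- k%:Z - 1, b', c')) = sub_pow k%:Z :> (_ -> F).
  apply: funext => -[b' c']; rewrite /delta_x0_21 opprB addrC addKr opprK.
  exact: sub_pow_sym.
move=> ->; apply: linear_series_mul_eq0 => -[[a' b'] c'] /=.
(* the delta function contributes only [x0^a'] with [a' >= 0], leaving the power
   [x0^(-k-1-a')] below the pole bound to the iterate *)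
case: ifP => [/andP[a'0 _]|_]; last by rewrite scale0r.
case: ifP => _; last by rewrite linear0 scaler0.
suff -> : f (YV_tens_id GV M (- k%:Z - 1 - a') (cm_Y CM (c - c') w)) = 0.
  by rewrite scaler0.
apply: v'0; rewrite (le_lt_trans (y := - k%:Z - 1)) ?gerBl //.
by rewrite ltrBlDr (@lt_le_trans _ _ (- N%:Z)) ?lerDl // ltrN2 ltz_nat.
Qed.
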